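(* For every $n\ge1$, there is a Følner sequence $\{F_l\}$ of approximate groups in the discrete Heisenberg group $\mathbb H_{2n+1}(\mathbb Z)$ such that both $(\mathbb H_{2n+1}(\mathbb Z),\{F_l\})$ and $(\mathbb H_{2n+1}(\mathbb Z),\{F_l^{-1}\})$ satisfy (WAFC).
   Context: A Følner sequence in a countable group $G$ is an increasing sequence $\{F_l\}_{l\ge1}$ of finite subsets with $e\in F_l$ for all $l$, $\bigcup_lF_l=G$, and $\lim_l|gF_l\triangle F_l|/|F_l|=0$ for all $g\in G$. A finite subset $A\subset G$ is a (weakly) approximate group with respect to a natural number $L>0$ if $e\in A$ and there are $g_1,\dots,g_L\in G$ with $A^{-1}A\subset\bigcup_{i=1}^Lg_iA$; the smallest such $L$ is $L_A$. $(G,\{F_l\})$ satisfies (WAFC) if $\{F_l\}$ is a Følner sequence, every $F_l$ is an approximate group, and there is a natural number $L_G$ with $L_{F_l}\le L_G$ for all $l\ge1$. $\mathbb H_{2n+1}(\mathbb Z)$ is $\mathbb Z^n\times\mathbb Z^n\times\mathbb Z$ with $(a,b,c)(a',b',c')=(a+a',b+b',c+c'+a\cdot b')$. *)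

(* Defs.v *)
From HB Require Import structures.
From mathcomp Require Import all_boot all_order all_algebra.
From mathcomp Require Import finmap ring.
From mathcomp Require Import boolp classical_sets reals topology normedtype.
Set Implicit Arguments.
Unset Strict Implicit.
Unset Printing Implicit Defensive.
Import GRing.Theory.
Import numFieldNormedType.Exports.

Local Open Scope fset_scope.

Section FiniteSubsets.
Variable G : groupType.
Implicit Types A B : {fset G}.

Definition fset_inv A : {fset G} := [fset (x^-1)%g | x in A].

Definition fset_mul A B : {fset G} := [fset (x * y)%g | x in A, y in B].

Definition fset_trans (g : G) A : {fset G} := [fset (g * x)%g | x in A].

Definition fset_symdiff A B : {fset G} := (A `\` B) `|` (B `\` A).

(* The translates are not required to be distinct, so g_1, ..., g_L is a family
   indexed by 'I_L. *)
Definition approx_group_wrt A (L : nat) : Prop :=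
  [/\ (0 < L)%N, (1%g : G) \in A &
      exists g : 'I_L -> G,
        fset_mul (fset_inv A) A `<=` \bigcup_(i in 'I_L) fset_trans (g i) A].

Definition approx_group A : Prop := exists L : nat, approx_group_wrt A L.

Lemma approx_group_asbool A : approx_group A ->
  exists L : nat, `[< approx_group_wrt A L >].
Proof. by case=> L AL; exists L; apply/asboolP. Qed.

(* The least constant L_A, with the convention L_A = 0 when A is not an
   approximate group with respect to any L. *)
Definition approx_const A : nat :=
  if pselect (approx_group A) is left hA then ex_minn (approx_group_asbool hA)
  else 0%N.

Lemma approx_constP A : approx_group A ->
  approx_group_wrt A (approx_const A) /\
  forall L, approx_group_wrt A L -> (approx_const A <= L)%N.
Proof.
rewrite /approx_const; case: pselect => // hA _.
case: ex_minnP => m /asboolP Am m_min; split=> // L AL.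
by apply: m_min; apply/asboolP.
Qed.

(* Sequences are indexed by l >= 1; the value at 0 is irrelevant. *)
Definition folner_sequence (R : realType) (F : nat -> {fset G}) : Prop :=
  [/\ forall l, (1 <= l)%N -> F l `<=` F l.+1,
      forall l, (1 <= l)%N -> (1%g : G) \in F l,
      forall g : G, exists2 l, (1 <= l)%N & g \in F l &
      forall g : G,
        ((fun l => (#|` fset_symdiff (fset_trans g (F l)) (F l)|%:R
                    / #|` F l|%:R)%R : R) @ \oo --> (0%R : R))%classic].

Definition WAFC (R : realType) (F : nat -> {fset G}) : Prop :=
  [/\ folner_sequence R F,
      forall l, (1 <= l)%N -> approx_group (F l) &
      exists LG : nat, forall l, (1 <= l)%N -> (approx_const (F l) <= LG)%N].

End FiniteSubsets.

Local Open Scope ring_scope.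

(* The elements (a, b, c) of the Heisenberg group H_{2n+1}(Z). The product type
   is hidden behind a constant so that the group law below is not confused with
   a componentwise one. *)
Definition heisenberg (n : nat) : Type := ('rV[int]_n * 'rV[int]_n * int)%type.

HB.instance Definition _ n := Choice.copy (heisenberg n)
  ('rV[int]_n * 'rV[int]_n * int)%type.

Section Heisenberg.
Variable n : nat.
Implicit Types x y z : heisenberg n.

Definition dotz (a b : 'rV[int]_n) : int := \sum_i a 0 i * b 0 i.

Definition heis_mul x y : heisenberg n :=
  let: (a, b, c) := x in let: (a', b', c') := y in
  (a + a', b + b', c + c' + dotz a b').

Definition heis_one : heisenberg n := (0, 0, 0).

Definition heis_inv x : heisenberg n :=
  let: (a, b, c) := x in (- a, - b, - c + dotz a b).

Lemma dotzDl a a' b : dotz (a + a') b = dotz a b + dotz a' b.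
Proof. by rewrite -big_split; apply: eq_bigr => i _; rewrite mxE mulrDl. Qed.

Lemma dotzDr a b b' : dotz a (b + b') = dotz a b + dotz a b'.
Proof. by rewrite -big_split; apply: eq_bigr => i _; rewrite mxE mulrDr. Qed.

Lemma dotzNl a b : dotz (- a) b = - dotz a b.
Proof. by rewrite -sumrN; apply: eq_bigr => i _; rewrite mxE mulNr. Qed.

Lemma dotzNr a b : dotz a (- b) = - dotz a b.
Proof. by rewrite -sumrN; apply: eq_bigr => i _; rewrite mxE mulrN. Qed.

Lemma dotz0l b : dotz 0 b = 0.
Proof. by apply: big1 => i _; rewrite mxE mul0r. Qed.

Lemma dotz0r a : dotz a 0 = 0.
Proof. by apply: big1 => i _; rewrite mxE mulr0. Qed.

Lemma heis_mulA : associative heis_mul.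
Proof.
move=> [[a b] c] [[a' b'] c'] [[a'' b''] c'']; congr (_, _, _);
  [exact: addrA | exact: addrA | rewrite dotzDl dotzDr; ring].
Qed.

Lemma heis_mul1 : left_id heis_one heis_mul.
Proof. by move=> [[a b] c]; rewrite /= dotz0l !add0r addr0. Qed.

Lemma heis_mulr1 : right_id heis_one heis_mul.
Proof. by move=> [[a b] c]; rewrite /= dotz0r !addr0. Qed.

Lemma heis_mulV : left_inverse heis_one heis_inv heis_mul.
Proof.
move=> [[a b] c]; rewrite /= dotzNl !addNr; congr (_, _, _); ring.
Qed.

Lemma heis_mulrV : right_inverse heis_one heis_inv heis_mul.
Proof. by move=> [[a b] c]; rewrite /= dotzNr !subrr; congr (_, _, _); ring. Qed.

End Heisenberg.

HB.instance Definition _ n := isGroup.Build (heisenberg n)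
  (@heis_mulA n) (@heis_mul1 n) (@heis_mulr1 n)
  (@heis_mulV n) (@heis_mulrV n).

(* Main.v *)
Require Import Defs.
From mathcomp Require Import all_boot all_order all_algebra finmap reals.
From mathcomp Require Import boolp classical_sets topology normedtype.
From mathcomp Require Import sequences realfun.
From mathcomp Require Import zify ring.
Set Implicit Arguments.
Unset Strict Implicit.
Unset Printing Implicit Defensive.
Import Order.TTheory GRing.Theory Num.Theory.
Import numFieldNormedType.Exports.

(** In the coordinate [t = 2 c - a . b] the group law becomes
    [t (x y) = t x + t y + a . b' - a' . b], and inversion is
    [(a, b, t) |-> (- a, - b, - t)].  Hence the boxes
      [F_l = {|a_i| <= l, |b_i| <= l, |t| <= 2 n l^2}]
    are symmetric, so that [F_l^-1 = F_l] and one (WAFC) statement gives both.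
    They also satisfy [F_m F_l <= F_(m + l)], because the cross terms are at
    most [2 n m l] and [2 n m^2 + 2 n l^2 + 2 n m l <= 2 n (m + l)^2]
    ([in_boxM]).  The two remaining properties are scale invariance and
    polynomial growth.

    Approximate groups: [F_l^-1 F_l <= F_(2 l)], and [F_(2 l)] is covered by a
    number of left translates of [F_l] that depends only on [n].  To reach [x],
    divide [a] and [b] by [l] with remainder, translate by the quotients, and
    then correct [t], which has size [O(n l^2)], by a central multiple of
    [n l^2] ([box_cover]).

    Følner condition: if [g] lies in [F_m], both [F_l] and [g F_l] lie in
    [F_(m + l)], so [|g F_l /\ F_l| <= 2 (|F_(m + l)| - |F_l|)]
    ([card_symdiff_trans]), where [/\] is the symmetric difference.  Up to a
    parity effect in [t], the cardinal of [F_l] is [(2 l + 1)^(2 n) 2 n l^2],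
    which makes [|F_(m + l)| / |F_l|] tend to 1 for fixed [m]
    ([card_box_growth], [folner_of_growth]). *)

Local Open Scope fset_scope.

(** * Approximate groups and the Følner condition in an arbitrary group *)

Section Groups.
Variable G : groupType.
Implicit Types (A B : {fset G}) (g x y : G).

Lemma in_fset_inv A x : (x \in fset_inv A) = ((x^-1)%g \in A).
Proof.
apply/imfsetP/idP => [[y yA ->]|xA]; first by rewrite invgK.
by exists (x^-1)%g; rewrite ?invgK.
Qed.

Lemma in_fset_trans g A x : (x \in fset_trans g A) = ((g^-1 * x)%g \in A).
Proof.
apply/imfsetP/idP => [[y yA ->]|xA]; first by rewrite mulKg.
by exists (g^-1 * x)%g; rewrite ?mulVKg.
Qed.

Lemma card_fset_trans g A : #|` fset_trans g A| = #|` A|.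
Proof. by rewrite card_imfset //; exact: mulgI. Qed.

(** Indexing by a finite type lets the covering translates be labelled by
    coordinates; the constant is then the number of labels. *)
Lemma approx_group_wrt_cover (I : finType) (g : I -> G) A :
    (1%g : G) \in A ->
    (forall x y, x \in A -> y \in A ->
      exists i, ((g i)^-1 * (x^-1 * y))%g \in A) ->
  approx_group_wrt A #|I|.
Proof.
move=> A1 cov; split=> //.
  by have [i _] := cov _ _ A1 A1; apply/card_gt0P; exists i.
exists (fun k => g (enum_val k)); apply/fsubsetP => z /imfset2P[x xA [y yA ->]].
rewrite [in_mem _ _]in_fset_inv in xA.
have [i giA] := cov _ _ xA yA.
apply/bigfcupP; exists (enum_rank i); first by rewrite mem_index_enum.
by rewrite enum_rankK in_fset_trans; rewrite invgK in giA.
Qed.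

Lemma approx_const_le A L : approx_group_wrt A L -> (approx_const A <= L)%N.
Proof.
by move=> AL; have [_] := @approx_constP G A (ex_intro _ L AL); exact.
Qed.

(** Since [g A] and [A] have the same cardinal, the two halves of the symmetric
    difference do too, and [g A \ A] is contained in [B \ A]. *)
Lemma card_symdiff_trans g A B : A `<=` B -> fset_trans g A `<=` B ->
  (#|` fset_symdiff (fset_trans g A) A| <= 2 * (#|` B| - #|` A|))%N.
Proof.
move=> AB gAB; have gA := card_fset_trans g A.
have h1 : (#|` fset_trans g A `\` A| <= #|` B `\` A|)%N.
  by apply/fsubset_leq_card/fsetSD.
have h2 : (#|` A `\` fset_trans g A| = #|` fset_trans g A `\` A|)%N.
  by rewrite !cardfsD gA fsetIC.
have h3 : #|` B `\` A| = (#|` B| - #|` A|)%N.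
  by rewrite cardfsD (fsetIidPr AB).
have := cardfsU (fset_trans g A `\` A) (A `\` fset_trans g A).
rewrite /fset_symdiff; lia.
Qed.

(** If [g] has filtration degree [m], then [F (m + l)] contains [F l] and
    [g F l], so the Følner ratio is at most
    [2 (|F (m + l)| / |F l| - 1) <= 2 ((1 + (m + 1) / l) ^ D - 1)]. *)
Lemma folner_of_growth (R : realType) (F : nat -> {fset G}) (D : nat) :
    (forall l, (1 : G)%g \in F l) ->
    (forall g, exists m, g \in F m) ->
    (forall m l x y, x \in F m -> y \in F l -> (x * y)%g \in F (m + l)%N) ->
    (forall m l, (0 < l)%N ->
      (#|` F (m + l)%N| * l ^ D <= #|` F l| * (m + l).+1 ^ D)%N) ->
  folner_sequence R F.
Proof.
move=> F1 Fex FM Fgrowth.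
have Fmono m l : F l `<=` F (m + l)%N.
  by apply/fsubsetP => x xF; rewrite -[x]mul1g FM.
split=> // [l _|g|g]; first exact: (Fmono 1%N).
  have [m gm] := Fex g; exists (1 + m)%N => //.
  exact: (fsubsetP (Fmono 1%N m)).
have [m gm] := Fex g.
(* Shifting the index by one avoids dividing by l = 0. *)
rewrite -cvg_shiftS /=.
pose u (l : nat) : R := (2 * ((1 + m.+1%:R * harmonic l) ^+ D - 1))%R.
apply: (@squeeze_cvgr _ _ _ _ (fun=> 0%R) u).
- near=> l; apply/andP; split; first by rewrite divr_ge0 ?ler0n.
  set k := l.+1.
  have Fk : (0 < #|` F k|)%N by rewrite cardfs_gt0; apply/fset0Pn; exists 1%g.
  rewrite ler_pdivrMr ?ltr0n //.
  have sd : (#|` fset_symdiff (fset_trans g (F k)) (F k)|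
              <= 2 * (#|` F (m + k)%N| - #|` F k|))%N.
    apply: card_symdiff_trans => //.
    apply/fsubsetP => x; rewrite in_fset_trans => xF.
    by rewrite -[x](mulVKg g) FM.
  have le := fsubset_leq_card (Fmono m k).
  have kn0 : (k%:R != 0 :> R)%R by rewrite pnatr_eq0.
  have kD : (0 < (k%:R : R) ^+ D)%R by rewrite exprn_gt0 ?ltr0n.
  have -> : u l = (2 * (((m + k).+1%:R / k%:R) ^+ D - 1))%R.
    rewrite /u /harmonic /=; congr (2 * (_ ^+ _ - 1))%R.
    by rewrite -[l.+1]/k -addSn natrD; field.
  apply: (@le_trans _ _ (2 * (#|` F (m + k)%N|%:R - #|` F k|%:R))%R).
    by rewrite -natrB // -natrM ler_nat.
  rewrite -mulrA ler_pM2l ?ltr0n // mulrBl mul1r lerD2r.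
  rewrite expr_div_n mulrAC ler_pdivlMr // mulrC [leRHS]mulrC.
  by rewrite -!natrX -!natrM ler_nat [leqLHS]mulnC Fgrowth.
- exact: cvg_cst.
rewrite (_ : 0%R = (2 * ((1 + m.+1%:R * 0) ^+ D - 1))%R :> R); last first.
  by rewrite mulr0 addr0 expr1n subrr mulr0.
apply: cvgMl_tmp; apply: cvgB; last exact: cvg_cst.
apply: (continuous_cvg _ (@exprn_continuous R D _)); apply: cvgD.
  exact: cvg_cst.
by apply: cvgMl_tmp; exact: cvg_harmonic.
Unshelve. all: by end_near. Qed.

End Groups.

(** * A filtration of the Heisenberg group by symmetric boxes *)

Local Open Scope ring_scope.

Section Heisenberg.
Variable n : nat.
Implicit Types (a b : 'rV[int]_n) (x y : heisenberg n) (l m : nat).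

Definition in_cube (l : nat) a : bool := [forall i, `|a 0 i| <= l%:Z].

(** Twice the central coordinate in exponential coordinates of the Lie group:
    inversion changes its sign, and it is a homomorphism up to a symplectic
    form in the other coordinates. *)
Definition skew x : int := 2 * x.2 - dotz x.1.1 x.1.2.

(** The weights 1, 1, 2 of the coordinates are those of the dilations of the
    Heisenberg group. The constant [2 * n] is large enough to absorb the
    symplectic cross terms of a product, which are at most [2 * n * m * l], and
    it is even so that the boxes are easy to count. *)
Definition in_box (l : nat) x : bool :=
  [&& in_cube l x.1.1, in_cube l x.1.2 & `|skew x| <= (2 * n * l ^ 2)%N%:Z].

Lemma heisM x y : (x * y)%g =
  (x.1.1 + y.1.1, x.1.2 + y.1.2, x.2 + y.2 + dotz x.1.1 y.1.2).
Proof. by case: x y => [[a b] c] [[a' b'] c']. Qed.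

Lemma heisV x :
  (x^-1)%g = (- x.1.1, - x.1.2, - x.2 + dotz x.1.1 x.1.2).
Proof. by case: x => [[a b] c]. Qed.

Lemma skewM x y : skew (x * y)%g =
  skew x + skew y + dotz x.1.1 y.1.2 - dotz y.1.1 x.1.2.
Proof. by rewrite /skew heisM /= dotzDl !dotzDr; ring. Qed.

Lemma skewV x : skew (x^-1)%g = - skew x.
Proof. by rewrite /skew heisV /= dotzNl dotzNr; ring. Qed.

Lemma in_cubeN l a : in_cube l (- a) = in_cube l a.
Proof. by apply: eq_forallb => i; rewrite mxE normrN. Qed.

Lemma in_cubeD l m a b :
  in_cube l a -> in_cube m b -> in_cube (l + m) (a + b).
Proof.
move=> /forallP al /forallP bm; apply/forallP => i; rewrite mxE.
by move: (a 0 i) (b 0 i) (al i) (bm i) => u v; lia.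
Qed.

Lemma norm_dotz_le l m a b : in_cube l a -> in_cube m b ->
  `|dotz a b| <= (n * l * m)%N%:Z.
Proof.
move=> /forallP al /forallP bm; apply: le_trans (ler_norm_sum _ _ _) _.
apply: (@le_trans _ _ (\sum_(i < n) (l * m)%N%:Z)).
  by apply: ler_sum => i _; rewrite normrM PoszM; exact: ler_pM.
by rewrite sumr_const card_ord -mulr_natl natz -PoszM mulnA.
Qed.

Lemma in_boxV l x : in_box l (x^-1)%g = in_box l x.
Proof. by rewrite /in_box skewV normrN heisV /= !in_cubeN. Qed.

(** The slack [2 n (m + l)^2 - 2 n m^2 - 2 n l^2 = 4 n m l] exceeds the bound
    [2 n m l] on the cross terms. *)
Lemma in_boxM l m x y :
  in_box m x -> in_box l y -> in_box (m + l) (x * y)%g.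
Proof.
move=> /and3P[xa xb xc] /and3P[ya yb yc]; apply/and3P.
split; [by rewrite heisM in_cubeD..|rewrite skewM].
have := norm_dotz_le xa yb; have := norm_dotz_le ya xb.
nia.
Qed.

Lemma in_box1 l : in_box l (1%g : heisenberg n).
Proof.
apply/and3P; split; [by apply/forallP => i; rewrite mxE..|].
by rewrite /skew /= dotz0l.
Qed.

Lemma in_cube_exists a : exists m, in_cube m a.
Proof.
exists (\sum_i `|(a 0 i)%R|)%N; apply/forallP => i.
rewrite (bigD1 i) //=; move: (a 0 i) => u; lia.
Qed.

Lemma in_cubeW l m a : (l <= m)%N -> in_cube l a -> in_cube m a.
Proof.
by move=> lm /forallP al; apply/forallP => i; move: (a 0 i) (al i) => u; lia.
Qed.

Lemma in_box_exists x : (0 < n)%N -> exists m, in_box m x.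
Proof.
move=> n0; have [p xa] := in_cube_exists x.1.1.
have [q xb] := in_cube_exists x.1.2.
exists (p + q + `|skew x|)%N; apply/and3P; split.
- by apply: in_cubeW xa; lia.
- by apply: in_cubeW xb; lia.
- by nia.
Qed.

(** * Counting the boxes *)

Definition cube_point (l : nat) (p : 'rV['I_(2 * l).+1]_n) : 'rV[int]_n :=
  \row_i ((p 0 i)%:Z - l%:Z).

Lemma cube_point_inj l : injective (@cube_point l).
Proof.
move=> p p' /rowP pp; apply/rowP => i; apply/val_inj.
by have := pp i; rewrite !mxE /=; lia.
Qed.

Lemma cube_pointP l a : reflect (exists p, a = @cube_point l p) (in_cube l a).
Proof.
apply: (iffP forallP) => [al|[p ->] i]; last first.
  by rewrite mxE; have := ltn_ord (p 0 i); lia.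
exists (\row_i inord `|a 0 i + l%:Z|).
apply/rowP => i; move: (al i); rewrite !mxE; move: (a 0 i) => u ul.
by rewrite inordK; lia.
Qed.

(** Measuring the central coordinate from the integer part of [a . b / 2] turns
    a box into a product, up to the rounding error of that integer part. *)
Definition grid_point (l : nat) (s : int) (N : nat)
    (u : 'rV['I_(2 * l).+1]_n * 'rV['I_(2 * l).+1]_n * 'I_N) : heisenberg n :=
  let a := cube_point u.1.1 in
  let b := cube_point u.1.2 in
  (a, b, (dotz a b %/ 2)%Z + s + (u.2)%:Z).

Definition grid (l : nat) (s : int) (N : nat) : {fset heisenberg n} :=
  [fset grid_point s u | u in
    {: 'rV['I_(2 * l).+1]_n * 'rV['I_(2 * l).+1]_n * 'I_N}].

Lemma card_grid l s N : #|` grid l s N| = ((2 * l).+1 ^ (2 * n) * N)%N.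
Proof.
rewrite card_imfset /=.
  rewrite -cardE !card_prod !card_mx !card_ord !mul1n -expnD.
  by rewrite addnn -(mul2n n).
move=> [[p q] u] [[p' q'] u'] [/cube_point_inj <- /cube_point_inj <- uu].
by congr (_, _); apply/val_inj => /=; lia.
Qed.

Lemma gridP l s N x : reflect
  [/\ in_cube l x.1.1, in_cube l x.1.2 &
      s <= x.2 - (dotz x.1.1 x.1.2 %/ 2)%Z < s + N%:Z]
  (x \in grid l s N).
Proof.
apply: (iffP idP) => [/imfsetP[u _ ->]|[]].
  split; try by apply/cube_pointP; eexists.
  rewrite /=; set d := (_ %/ 2)%Z.
  by move: (ltn_ord u.2); move: (u.2 : nat) => k; lia.
case: x => [[a b] c] /= /cube_pointP[p ->] /cube_pointP[q ->] xc.
set d := (dotz _ _ %/ 2)%Z in xc *.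
have kN : (`|(c - d - s)%R| < N)%N by lia.
apply/imfsetP; exists (p, q, Ordinal kN) => //=.
by rewrite /grid_point /= -/d; congr (_, _); lia.
Qed.

(** The grid contains all solutions of [in_box] ([boxE]), so it shows that they
    are finite in number and bounds that number from above. *)
Definition box (l : nat) : {fset heisenberg n} :=
  [fset x in grid l (- (n * l ^ 2)%N%:Z) (2 * n * l ^ 2).+1 | in_box l x].

Lemma boxE l x : (x \in box l) = in_box l x.
Proof.
rewrite !inE /= andb_idl // => /and3P[xa xb xc]; apply/gridP; split=> //.
move: xc; rewrite /skew; lia.
Qed.

Lemma fset_inv_box l : fset_inv (box l) = box l.
Proof. by apply/fsetP => x; rewrite in_fset_inv !boxE in_boxV. Qed.

Lemma card_box_le l :
  (#|` box l| <= (2 * l).+1 ^ (2 * n) * (2 * n * l ^ 2).+1)%N.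
Proof.
rewrite -(card_grid l (- (n * l ^ 2)%N%:Z)); apply: fsubset_leq_card.
by apply/fsubsetP => x; rewrite !inE => /andP[].
Qed.

(** If [a . b] is odd, [skew] lies one below twice the offset from the integer
    part, so the least offset [- n l^2] is lost; all others are always
    allowed. *)
Lemma card_box_ge l :
  ((2 * l).+1 ^ (2 * n) * (2 * n * l ^ 2) <= #|` box l|)%N.
Proof.
rewrite -(card_grid l (1 - (n * l ^ 2)%N%:Z)); apply: fsubset_leq_card.
apply/fsubsetP => x /gridP[xa xb xc]; rewrite boxE; apply/and3P; split=> //.
move: xc; rewrite /skew; lia.
Qed.

(** Compare the upper bound at [m + l] with the lower bound at [l] factor by
    factor: [(2 k + 1) l <= (2 l + 1) (k + 1)] in each of the [2 n] horizontal
    directions, and [2 n k^2 + 1 <= 2 n (k + 1)^2] in the central one. *)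
Lemma card_box_growth m l : (0 < n)%N ->
  (#|` box (m + l)| * l ^ (2 * n + 2) <=
   #|` box l| * (m + l).+1 ^ (2 * n + 2))%N.
Proof.
move=> n0; have := card_box_le (m + l); have := card_box_ge l.
set k := (m + l)%N => lo hi; have lk : (l <= k)%N by rewrite leq_addl.
apply: (leq_trans (leq_mul hi (leqnn _))).
apply: (leq_trans _ (leq_mul lo (leqnn _))).
rewrite !(expnD _ (2 * n) 2) mulnACA [leqRHS]mulnACA -!expnMn; apply: leq_mul.
  by rewrite leq_exp2r ?muln_gt0 //; nia.
by nia.
Qed.

(** * Covering a box of double size by translates *)

(** The quotients of numbers in [[-2 l, 2 l]] by [l] lie in [[-2, 2]], and the
    remainders in [[0, l - 1]]. *)
Lemma cube_round l a : (0 < l)%N -> in_cube (l + l) a ->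
  exists p : 'rV['I_(2 * 2).+1]_n, in_cube l (a - l%:Z *: cube_point p).
Proof.
move=> l0 /forallP al; pose q : 'rV[int]_n := \row_i ((a 0 i)%R %/ l%:Z)%Z.
have /cube_pointP[p qp] : in_cube 2 q.
  by apply/forallP => i; rewrite mxE; move: (al i); move: (a _ i) => u; nia.
exists p; rewrite -qp; apply/forallP => i; rewrite !mxE.
by move: (a _ i) => u; nia.
Qed.

(** The translates that cover the double box; [i.2] stands for an integer
    between -10 and 10. *)
Definition center (l : nat)
    (i : 'rV['I_(2 * 2).+1]_n * 'rV['I_(2 * 2).+1]_n * 'I_21) : heisenberg n :=
  (l%:Z *: cube_point i.1.1, l%:Z *: cube_point i.1.2,
   (n * l ^ 2)%N%:Z * ((i.2)%:Z - 10)).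

Lemma in_cubeZ l a m : in_cube m a -> in_cube (l * m) (l%:Z *: a).
Proof.
move=> /forallP am; apply/forallP => i; rewrite mxE.
by move: (a 0 i) (am i) => u; nia.
Qed.

(** After the horizontal coordinates are rounded, the central one must be
    brought into a window of half-width [2 n l^2]. Central translations by
    multiples of [n l^2] move [skew] in steps of [2 n l^2], and boundedly many
    steps are enough. *)
Lemma box_cover l x : (0 < n)%N -> (0 < l)%N -> in_box (l + l) x ->
  exists i, in_box l ((center l i)^-1 * x)%g.
Proof.
move=> n0 l0 /and3P[xa xb xc].
have [p ap] := cube_round l0 xa; have [q bq] := cube_round l0 xb.
set u := l%:Z *: cube_point p in ap; set v := l%:Z *: cube_point q in bq.
have cu : in_cube (l * 2) u by apply/in_cubeZ/cube_pointP; exists p.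
have cv : in_cube (l * 2) v by apply/in_cubeZ/cube_pointP; exists q.
(* [T] is [skew] of the remainder when the centre has central coordinate 0;
   its bound 20 n l^2 is 8 n l^2 from [x] and 4 n l^2 from each product. *)
pose T := skew x + dotz u v - dotz u x.1.2 + dotz x.1.1 v.
have T20 : `|T| <= (20 * (n * l ^ 2))%N%:Z.
  have := norm_dotz_le cu cv; have := norm_dotz_le cu xb.
  have := norm_dotz_le xa cv; rewrite /T; lia.
pose N := (n * l ^ 2)%N; have N0 : (0 < N)%N by rewrite muln_gt0 n0 expn_gt0 l0.
pose j := (T %/ (2 * N%:Z))%Z.
have j10 : `|j| <= 10 by rewrite /j; nia.
have jT : `|T - 2 * (N%:Z * j)| <= 2 * N%:Z by rewrite /j; nia.
have k21 : (`|(j + 10)%R| < 21)%N by lia.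
exists (p, q, Ordinal k21); apply/and3P; split.
- by rewrite heisM heisV /= addrC.
- by rewrite heisM heisV /= addrC.
have jE : (absz (j + 10))%:Z - 10 = j by lia.
rewrite skewM skewV heisV /= {1}/skew /= dotzNl dotzNr jE -/u -/v.
rewrite -/N -mulnA -/N.
have -> : - (2 * (N%:Z * j) - dotz u v) + skew x - dotz u x.1.2 - - dotz x.1.1 v
    = T - 2 * (N%:Z * j) by rewrite /T; ring.
by rewrite PoszM.
Qed.

Lemma box_approx_group l : (0 < n)%N -> (0 < l)%N ->
  approx_group_wrt (box l) (5 ^ n * 5 ^ n * 21).
Proof.
move=> n0 l0.
have := @approx_group_wrt_cover _ _ (center l) (box l).
rewrite !card_prod !card_mx !card_ord mul1n; apply.
  by rewrite boxE in_box1.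
move=> x y; rewrite !boxE => xl yl.
have [|i ci] := @box_cover l (x^-1 * y)%g n0 l0.
  by apply: in_boxM; rewrite ?in_boxV.
by exists i; rewrite boxE.
Qed.

Lemma box_WAFC (R : realType) : (0 < n)%N -> WAFC R box.
Proof.
move=> n0; split.
- apply: (@folner_of_growth _ R box (2 * n + 2)).
  + by move=> l; rewrite boxE in_box1.
  + by move=> x; have [m xm] := in_box_exists x n0; exists m; rewrite boxE.
  + by move=> m l x y; rewrite !boxE; exact: in_boxM.
  + by move=> m l _; exact: card_box_growth.
- by move=> l l0; exists (5 ^ n * 5 ^ n * 21)%N; exact: box_approx_group.
- exists (5 ^ n * 5 ^ n * 21)%N => l l0.
  by apply/approx_const_le/box_approx_group.
Qed.

End Heisenberg.

Theorem corollary3p2p3 (R : realType) (n : nat) (hn : (1 <= n)%N) :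
  exists F : nat -> {fset heisenberg n},
    [/\ folner_sequence R F,
        forall l : nat, (1 <= l)%N -> approx_group (F l),
        WAFC R F &
        WAFC R (fun l => fset_inv (F l))].
Proof.
have boxW := @box_WAFC n R hn.
exists (@box n); split=> //; try by case: boxW.
rewrite (_ : (fun l => _) = @box n) //.
by apply/funext => l; exact: fset_inv_box.
Qed.
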